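(* Let $(O,P,I)$ be a formal context with $O$ and $P$ finite, let $n$ be a positive integer, and let $O_{S_1},\ldots,O_{S_n}$ be pairwise disjoint subsets of $O$ with $O_{S_1}\cup\cdots\cup O_{S_n}=O$. For each $k$ let $S_k=(O_{S_k},P,I_{S_k})$ with $I_{S_k}=I\cap(O_{S_k}\times P)$, and let $S=(O,P,I)$. Then for every attribute set $Y\subseteq P$, with $\mathcal{F}^{Y}_{S_k}$ denoting the closure of $Y$ with respect to $S_k$ and $\mathcal{F}^{Y}_{S}$ the closure of $Y$ with respect to $S$, $$\mathcal{F}^{Y}_{S}=\mathcal{F}^{Y}_{S_1}\cap\cdots\cap\mathcal{F}^{Y}_{S_n}.$$
   Context: A formal context is a triple $(O,P,I)$ where $O$ is a set of objects, $P$ a set of attributes and $I\subseteq O\times P$ a binary relation; $(t,p)\in I$ means that object $t$ has attribute $p$. For a formal context $T=(O_T,P,I_T)$ the derivation operators are: for $X\subseteq O_T$, $X'_T=\{p\in P \mid \forall t\in X: (t,p)\in I_T\}$; for $Y\subseteq P$, $Y'_T=\{t\in O_T\mid \forall p\in Y: (t,p)\in I_T\}$. By this convention, the derivation of the empty object set is all of $P$. The closure of an attribute set $Y\subseteq P$ with respect to $T$ is $\mathcal{F}^{Y}_{T}=Y''_T=(Y'_T)'_T\subseteq P$. All partitions of a dataset share the same attribute set $P$; only the objects are divided. *)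

(* Defs.v *)
From mathcomp Require Import all_boot.

Set Implicit Arguments.
Unset Strict Implicit.
Unset Printing Implicit Defensive.

(* The attribute set is the whole type P, shared by all contexts; the objects
   of a context form a subset of an ambient finite type U, so that a context
   and its parts have the same type. *)
Record context (U P : finType) := Context {
  objects : {set U};
  incidence : {set U * P};
  incidence_sub : incidence \subset setX objects [set: P]
}.

Section Derivation.

Variables (U P : finType) (T : context U P).

(* X'_T, intended for X \subset objects T; equals [set: P] when X = set0. *)
Definition deriv_objects (X : {set U}) : {set P} :=
  [set p | [forall t in X, (t, p) \in incidence T]].

Definition deriv_attributes (Y : {set P}) : {set U} :=
  [set t in objects T | [forall p in Y, (t, p) \in incidence T]].

Definition context_closure (Y : {set P}) : {set P} :=
  deriv_objects (deriv_attributes Y).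

End Derivation.

Section Restriction.

Variables (U P : finType) (T : context U P) (A : {set U}).

Lemma restrict_incidence_sub :
  incidence T :&: setX A [set: P] \subset setX A [set: P].
Proof. exact: subsetIr. Qed.

(* The part (A, P, I :&: (A x P)), intended for A \subset objects T. *)
Definition restrict_context : context U P := Context restrict_incidence_sub.

End Restriction.

(* Main.v *)
(* Derivation turns unions of object sets into intersections of attribute sets,
   and restricting a context to A only intersects the derivation of Y with A;
   so the derivation of Y in S is the union of its derivations in the parts. *)
Require Import Defs.
From mathcomp Require Import all_boot.

(** Both sides quantify over all objects of all [X i], merely grouped differently; empty members
    impose no condition. *)
Lemma deriv_objects_bigcup (U P I : finType) (T : context U P)
    (X : I -> {set U}) :
  deriv_objects T (\bigcup_i X i) = \bigcap_i deriv_objects T (X i).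
Proof.
apply/setP=> p; rewrite inE.
apply/forall_inP/bigcapP => [Tp i _ | Tp t /bigcupP[i _ Xit]].
  by rewrite inE; apply/forall_inP=> t Xit; apply: Tp; apply/bigcupP; exists i.
by have := Tp i isT; rewrite inE => /forall_inP; apply.
Qed.

Lemma in_incidence_restrict (U P : finType) (T : context U P) (A : {set U})
    (t : U) (p : P) :
  t \in A ->
  ((t, p) \in incidence (restrict_context T A)) = ((t, p) \in incidence T).
Proof. by move=> At; rewrite !inE /= At !andbT. Qed.

(** Only pairs with object in [X] are tested, and on those the two incidences agree. *)
Lemma deriv_objects_restrict (U P : finType) (T : context U P) (A X : {set U}) :
  X \subset A -> deriv_objects (restrict_context T A) X = deriv_objects T X.
Proof.
move=> /subsetP sXA; apply/setP=> p; rewrite !inE.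
by apply: eq_forallb_in => t /sXA; apply: in_incidence_restrict.
Qed.

Lemma deriv_attributes_restrict (U P : finType) (T : context U P)
    (A : {set U}) (Y : {set P}) :
  A \subset objects T ->
  deriv_attributes (restrict_context T A) Y = A :&: deriv_attributes T Y.
Proof.
move=> /subsetP sAT; apply/setP=> t; rewrite !inE /=.
case At: (t \in A) => //=; rewrite sAT //=.
by apply: eq_forallb_in => p _; apply: in_incidence_restrict.
Qed.

(** Expresses the closure in a part through the incidence of [T] alone, so that different parts can
    be combined. *)
Lemma context_closure_restrict (U P : finType) (T : context U P)
    (A : {set U}) (Y : {set P}) :
  A \subset objects T ->
  context_closure (restrict_context T A) Y =
  deriv_objects T (A :&: deriv_attributes T Y).
Proof.
move=> sAT; rewrite /context_closure deriv_attributes_restrict //.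
by rewrite deriv_objects_restrict ?subsetIl.
Qed.

Theorem theorem2 (U P : finType) (S : context U P) (n : nat) (n_gt0 : 0 < n)
    (OS : 'I_n -> {set U})
    (OS_disjoint : forall i j : 'I_n, i != j -> [disjoint OS i & OS j])
    (OS_cover : \bigcup_(k < n) OS k = objects S)
    (Y : {set P}) :
  context_closure S Y =
  \bigcap_(k < n) context_closure (restrict_context S (OS k)) Y.
Proof.
have sOS k : OS k \subset objects S by rewrite -OS_cover (bigcup_sup k).
under eq_bigr => k _ do rewrite context_closure_restrict //.
rewrite -deriv_objects_bigcup; congr deriv_objects.
(* Intersection distributes over union, so the pieces add up to
   [objects S :&: deriv_attributes S Y], whose second factor lies in the first. *)
rewrite -big_distrl /= OS_cover; apply/esym/setIidPr.
by apply/subsetP=> t; rewrite inE => /andP[].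
Qed.
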